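(* Let $d \geq 1$ be an integer, let $\lambda > 0$ be a real number, and let $Q \subset \mathbb{R}^d$ be a convex polytope such that $Q \subseteq -\lambda Q$. Then there exist at most $2d$ vertices of $Q$ whose convex hull $Q'$ satisfies $$Q \subseteq -(\lambda + 2)\, d \, Q'.$$
   Context: For a set $A \subset \mathbb{R}^d$ and a real number $t$, $tA = \{ t a : a \in A\}$; in particular $-\lambda Q = \{-\lambda x : x \in Q\}$. A convex polytope is the convex hull of finitely many points. *)

(* Defs.v *)
From mathcomp Require Import all_boot all_order all_algebra.
From mathcomp Require Import all_classical all_reals all_analysis.

Set Implicit Arguments.
Unset Strict Implicit.
Unset Printing Implicit Defensive.

Import Order.TTheory GRing.Theory Num.Theory.
Local Open Scope classical_set_scope.
Local Open Scope ring_scope.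

Definition convex_hull (R : numDomainType) (M : lmodType R) (A : set M) :
  set M := smallest (@convex_set R M) A.

(* The generating set may be empty, so the empty set counts as a polytope. *)
Definition polytope (R : numDomainType) (M : lmodType R) (Q : set M) : Prop :=
  exists2 S : set M, finite_set S & Q = convex_hull S.

(* Vertices are the extreme points: the points of Q that lie in the relative
   interior of no nondegenerate segment contained in Q. *)
Definition vertices (R : numDomainType) (M : lmodType R) (Q : set M) : set M :=
  [set x | Q x /\ forall (y z : M) (t : R), Q y -> Q z -> 0 < t < 1 ->
                    x = t *: y + (1 - t) *: z -> y = z].

(* Main.v *)
Require Import Defs.
From mathcomp Require Import all_boot all_order all_algebra.
From mathcomp Require Import all_classical all_reals all_analysis.
From mathcomp Require Import ring lra.

(** Write [Q], assumed nonempty, as the convex hull of finitely many of its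
    vertices [p_1, ..., p_n] ([polytope_vertices]).  Some [v_1, ..., v_d] among
    the [p_j], possibly with repetitions, are such that every [p_j] is a
    combination [\sum_i b_i v_i] with all [|b_i| <= 1]
    ([bounded_coordinates_padded]).  When the [p_j] span the space, a choice for
    which the simplex with vertices [0, v_1, ..., v_d] has largest volume works,
    by Cramer's rule; in general one maximizes the volume within their span.

    Put [s = \sum_i v_i].  The point [s / d] lies in [Q], hence by hypothesis
    [- s / (lambda d)] lies in [Q] too, so that [- s] is a nonnegative
    combination of the [p_j] of total weight [lambda d].  A conic form of
    Caratheodory's theorem ([conic_caratheodory]) replaces it by a combination
    [\sum_k c_k w_k] of at most [d] of the [p_j], of total weight at most
    [lambda d].  The set [Q'] is the convex hull of the [v_i] and the [w_k].

    The relation [\sum_i v_i + \sum_k c_k w_k = 0], of positive total weight,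
    shows that [0] is in [Q'].  And, for [p_j = \sum_i b_i v_i],
      [- p_j = (s - p_j) - s = \sum_i (1 - b_i) v_i + \sum_k c_k w_k]
    has nonnegative coefficients of sum at most [2 d + lambda d]; since [0] is
    in [Q'], dividing by [(lambda + 2) d] gives a point of [Q']. *)

Set Implicit Arguments.
Unset Strict Implicit.
Unset Printing Implicit Defensive.

Import Order.TTheory GRing.Theory Num.Theory.
Local Open Scope classical_set_scope.
Local Open Scope ring_scope.

(** * Convex sets and barycenters *)

Lemma convex_setP (R : realFieldType) (M : lmodType R) (A : set M) :
  convex_set A <->
  forall (x y : M) (t : R), A x -> A y -> 0 <= t <= 1 ->
    A (t *: x + (1 - t) *: y).
Proof.
split=> [cA x y t Ax Ay /andP[t0 t1]|cA x y t /set_mem Ax /set_mem Ay].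
  by have /set_mem := cA x y (Itv01 t0 t1) (mem_set Ax) (mem_set Ay).
by apply/mem_set/cA => //; apply/andP; split.
Qed.

Lemma convex_barycenter (R : realFieldType) (M : lmodType R) (I : finType)
    (A : set M) (a : I -> R) (q : I -> M) :
  convex_set A -> (forall i, A (q i)) -> (forall i, 0 <= a i) ->
  0 < \sum_i a i -> A ((\sum_i a i)^-1 *: \sum_i a i *: q i).
Proof.
move=> /convex_setP cA Aq a0.
elim: (index_enum I) => [|i s IHs]; first by rewrite big_nil ltxx.
rewrite !big_cons; set c := \sum_(j <- s) a j in IHs *.
have [ci0 ai_gt0|c0] := eqVneq c 0.
  have -> : \sum_(j <- s) a j *: q j = 0.
    rewrite big_seq big1// => j js.
    move/eqP: ci0; rewrite /c psumr_eq0// => /allP/(_ j js)/eqP ->.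
    by rewrite scale0r.
  rewrite ci0 addr0 in ai_gt0 *.
  by rewrite addr0 scalerA mulVf ?gt_eqF// scale1r.
have c_gt0 : 0 < c by rewrite lt_neqAle eq_sym c0 sumr_ge0.
move=> ac; have := cA (q i) _ (a i / (a i + c)) (Aq i) (IHs c_gt0).
rewrite !(scalerA, scalerDr).
rewrite (_ : (1 - a i / (a i + c)) / c = (a i + c)^-1); last first.
  by field; rewrite c0 lt0r_neq0.
rewrite [_^-1 * a i]mulrC; apply.
by rewrite divr_ge0 ?(ltW ac)//= ler_pdivrMr// mul1r lerDl ltW.
Qed.

(** The missing weight [D - \sum_i a i] is put on the origin. *)
Lemma convex_subbarycenter (R : realFieldType) (M : lmodType R) (I : finType)
    (A : set M) (a : I -> R) (q : I -> M) (D : R) :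
  convex_set A -> A 0 -> (forall i, A (q i)) -> (forall i, 0 <= a i) ->
  \sum_i a i <= D -> 0 < D -> A (D^-1 *: \sum_i a i *: q i).
Proof.
move=> cA A0 Aq a0 aD D0; set c := \sum_i a i in aD.
have [c0|c0] := eqVneq c 0.
  rewrite big1 ?scaler0// => i _.
  by rewrite (psumr_eq0P _ c0)// scale0r.
have c_gt0 : 0 < c by rewrite lt_neqAle eq_sym c0 sumr_ge0.
have /convex_setP/(_ _ _ (c / D) (convex_barycenter cA Aq a0 c_gt0) A0) := cA.
rewrite scaler0 addr0 scalerA -/c mulrAC divff// mul1r; apply.
by rewrite divr_ge0 ?(ltW c_gt0) ?(ltW D0)//= ler_pdivrMr// mul1r.
Qed.

(** * Convex hulls and the vertices of a polytope *)

Lemma convex_hull_convex (R : realFieldType) (M : lmodType R) (A : set M) :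
  convex_set (convex_hull A).
Proof.
apply/convex_setP => x y t Ax Ay t01 B [cB AB].
by move/convex_setP: (cB); apply=> //; [apply: Ax|apply: Ay].
Qed.

Lemma convex_hull_min (R : realFieldType) (M : lmodType R) (A B : set M) :
  convex_set B -> A `<=` B -> convex_hull A `<=` B.
Proof. exact: smallest_sub. Qed.

Lemma sub_convex_hull (R : realFieldType) (M : lmodType R) (A : set M) :
  A `<=` convex_hull A.
Proof. exact: sub_gen_smallest. Qed.

Lemma convex_hull_rangeP (R : realFieldType) (M : lmodType R) (I : finType)
    (p : I -> M) (x : M) :
  convex_hull (range p) x ->
  exists a : I -> R, [/\ forall i, 0 <= a i, \sum_i a i = 1
    & x = \sum_i a i *: p i].
Proof.
move: x; apply: convex_hull_min.
  apply/convex_setP => _ _ t [a [a0 a1 ->]] [b [b0 b1 ->]] /andP[t0 t1].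
  exists (fun i => t * a i + (1 - t) * b i); split.
  - by move=> i; rewrite addr_ge0// mulr_ge0// subr_ge0.
  - by rewrite big_split/= -!mulr_sumr a1 b1; ring.
  - rewrite !scaler_sumr -big_split; apply: eq_bigr => i _ /=.
    by rewrite [in RHS]scalerDl !scalerA.
move=> _ [i _ <-]; exists (fun j => (j == i)%:R); split.
- by move=> j; exact: ler0n.
- by rewrite (bigD1 i)//= eqxx big1 ?addr0// => j /negPf ->.
- rewrite (bigD1 i)//= eqxx scale1r big1 ?addr0// => j /negPf ->.
  by rewrite scale0r.
Qed.

(** Suppose that [p i = t y + (1 - t) z] with [y], [z] in the hull, and average
    their barycentric weights into weights [c] of [p i].  If [c i < 1], solving
    for [p i] exhibits it as a barycenter of the other points, which is
    excluded.  So [c i = 1], which forces [y] and [z] to put all their weight on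
    [p i] as well. *)
Lemma vertex_outside_hull_of_others (R : realFieldType) (M : lmodType R) (n : nat)
    (p : 'I_n.+1 -> M) (i : 'I_n.+1) :
  ~ convex_hull (range (p \o lift i)) (p i) ->
  vertices (convex_hull (range p)) (p i).
Proof.
move=> pi_out; split; first by apply: sub_convex_hull; exists i.
move=> y z t /convex_hull_rangeP[a [a0 a1 yE]].
move=> /convex_hull_rangeP[b [b0 b1 zE]].
move=> /andP[t0 t1] pE; pose c j := t * a j + (1 - t) * b j.
have t'0 : 0 < 1 - t by rewrite subr_gt0.
have c0 j : 0 <= c j by rewrite addr_ge0// mulr_ge0// ltW.
have c1 : \sum_j c j = 1 by rewrite big_split/= -!mulr_sumr a1 b1; ring.
have {}pE : p i = \sum_j c j *: p j.
  rewrite [LHS]pE yE zE !scaler_sumr -big_split; apply: eq_bigr => j _ /=.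
  by rewrite [in RHS]scalerDl !scalerA.
have sum_lift (N : zmodType) (F : 'I_n.+1 -> N) :
    \sum_j F j = F i + \sum_j F (lift i j) by rewrite (bigD1_ord i).
rewrite sum_lift in c1; rewrite sum_lift in pE.
set s := \sum_j c (lift i j) in c1.
have [s0|s_neq0] := eqVneq s 0; last first.
  case: pi_out; have s_gt0 : 0 < s by rewrite lt_neqAle eq_sym s_neq0 sumr_ge0.
  have := convex_barycenter (q := p \o lift i)
    (@convex_hull_convex _ _ (range (p \o lift i))) _
    (fun j => c0 (lift i j)) s_gt0.
  have -> : \sum_j c (lift i j) *: (p \o lift i) j = s *: p i.
    rewrite [in RHS](_ : s = 1 - c i); last by rewrite -c1; ring.
    by rewrite scalerBl scale1r {1}pE addrC addKr.
  rewrite scalerA mulVf// scale1r; apply=> j.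
  by apply: sub_convex_hull; exists j.
have cl0 j : c (lift i j) = 0.
  by apply: (psumr_eq0P _ s0).
have al0 j : a (lift i j) = 0.
  have := cl0 j; rewrite /c; have := a0 (lift i j); have := b0 (lift i j).
  nra.
have bl0 j : b (lift i j) = 0.
  have := cl0 j; rewrite /c al0 mulr0 add0r => /eqP.
  by rewrite mulf_eq0 gt_eqF//= => /eqP.
have conc (e : 'I_n.+1 -> R) : (forall j, e (lift i j) = 0) ->
    \sum_j e j = 1 -> \sum_j e j *: p j = p i.
  move=> e0; rewrite !sum_lift !big1 ?addr0.
  - by move=> ->; rewrite scale1r.
  - by move=> j _; rewrite e0 scale0r.
  - by [].
by rewrite yE zE !conc.
Qed.

(** In a generating family of least size no point lies in the hull of the
    others, so that [vertex_outside_hull_of_others] applies to each of them. *)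
Lemma polytope_vertices (R : realFieldType) (M : lmodType R) (Q : set M) :
  polytope Q ->
  exists n (p : 'I_n -> M),
    Q = convex_hull (range p) /\ forall i, vertices Q (p i).
Proof.
move=> [S /finite_seqP[s ->] QE].
pose P n := `[< exists p : 'I_n -> M, Q = convex_hull (range p) >].
have exP : exists n, P n.
  exists (size s); apply/asboolP; exists (tnth (in_tuple s)).
  rewrite QE; congr convex_hull; apply/seteqP; split=> [x /= xs|_ [i _ <-]/=].
    by have /tnthP[i ->] : x \in in_tuple s by []; exists i.
  by rewrite -[X in _ \in X]/(tval (in_tuple s)) mem_tnth.
case: (ex_minnP exP) => n /asboolP[p Qp] nmin.
exists n, p; split=> // i.
case: n p Qp nmin i => [|n] p Qp nmin i; first by case: i.
rewrite Qp; apply: vertex_outside_hull_of_others => pi_in.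
suff : (n.+1 <= n)%N by rewrite ltnn.
apply/nmin/asboolP; exists (p \o lift i); rewrite Qp; apply/seteqP; split.
  apply: convex_hull_min (@convex_hull_convex _ _ _) _ => _ [j _ <-].
  have [k ->|-> //] := unliftP i j.
  by apply: sub_convex_hull; exists k.
apply: convex_hull_min (@convex_hull_convex _ _ _) _ => _ [j _ <-].
by apply: sub_convex_hull; exists (lift i j).
Qed.

(** * Coordinates of maximal volume *)

(** Let [k] be the dimension of the span of the [p j], and express them in a
    fixed basis of that span: their coordinates are the rows of the matrix [C]
    below.  Choose [k] of these rows, forming a matrix [B], with [|\det B|]
    largest.  By Cramer's rule the [i]-th coordinate of [p j] in the chosen
    family is [\det B' / \det B], where [B'] is [B] with its [i]-th row replaced
    by that of [p j]; it is at most [1] in absolute value by maximality. *)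
Lemma bounded_coordinates (R : realFieldType) (d n : nat)
    (p : 'I_n -> 'rV[R]_d) :
  exists k (f : 'I_k -> 'I_n), (k <= d)%N /\
    forall j, exists2 b : 'I_k -> R, (forall i, `|b i| <= 1)
      & p j = \sum_i b i *: p (f i).
Proof.
pose A := \matrix_(i < n) p i; pose C := col_base A.
pose vol (f : {ffun 'I_(\rank A) -> 'I_n}) := `|\det (rowsub f C)|.
pose f0 := fullrankfun (col_base_full A).
have vol0 : 0 < vol f0.
  by rewrite normr_gt0 -unitfE -unitmxE fullrowsub_unit.
case: (Order.TotalTheory.arg_maxP (i0 := f0) (P := xpredT) vol isT) => f _ fmax.
set B := rowsub f C in fmax.
have detB : \det B != 0.
  by rewrite -normr_gt0 (lt_le_trans vol0)//; exact: (fmax f0).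
exists (\rank A), f; split; first exact: rank_leq_col.
move=> j; pose b := (\det B)^-1 *: (row j C *m \adj B).
exists (b 0).
  move=> i.
  (* Cramer's rule, by expanding the determinant along the replaced row. *)
  pose g := [ffun l => if l == i then j else f l].
  have -> : b 0 i = (\det B)^-1 * \det (rowsub g C).
    rewrite mxE; congr (_ * _); rewrite mxE (expand_det_row _ i).
    apply: eq_bigr => l _; rewrite !mxE ffunE eqxx; congr (_ * _).
    rewrite /cofactor; congr (_ * \det _); apply/matrixP => r s.
    by rewrite !mxE ffunE eq_sym (negPf (neq_lift _ _)).
  rewrite normrM normfV ler_pdivrMl ?normr_gt0// mulr1.
  exact: (fmax g).
have bB : b *m B = row j C.
  rewrite -scalemxAl -mulmxA mul_adj_mx scalar_mxC mul_scalar_mx scalerA.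
  by rewrite mulVf// scale1r.
have -> : p j = row j A by rewrite rowK.
rewrite -[in LHS](mulmx_base A) row_mul -bB -mulmxA mul_rowsub_mx mulmx_base.
rewrite mulmx_sum_row; apply: eq_bigr => i _.
by rewrite row_rowsub rowK.
Qed.

(** Repeating [j0] with coordinate [0] makes the number of chosen points exactly
    [d].  In particular the family is nonempty when [d > 0], even if all the
    points are zero. *)
Lemma bounded_coordinates_padded (R : realFieldType) (d n : nat)
    (p : 'I_n -> 'rV[R]_d) (j0 : 'I_n) :
  exists f : 'I_d -> 'I_n, forall j, exists2 b : 'I_d -> R,
    (forall i, `|b i| <= 1) & p j = \sum_i b i *: p (f i).
Proof.
have [k [f [kd fP]]] := bounded_coordinates p.
pose P m := exists f : 'I_m -> 'I_n, forall j, exists2 b : 'I_m -> R,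
  (forall i, `|b i| <= 1) & p j = \sum_i b i *: p (f i).
suff : P (k + (d - k))%N by rewrite subnKC.
exists (fun i => if fintype.split i is inl i' then f i' else j0) => j.
have [b b1 ->] := fP j.
exists (fun i => if fintype.split i is inl i' then b i' else 0).
  by move=> i; case: fintype.split => [i'|_] //; rewrite normr0.
rewrite big_split_ord/= [X in _ + X]big1 ?addr0 => [|i _].
  apply: eq_bigr => i _.
  by rewrite -[lshift _ i]/(unsplit (inl i)) unsplitK.
by rewrite -[rshift _ i]/(unsplit (inr i)) unsplitK scale0r.
Qed.

(** * A conic form of Caratheodory's theorem *)

(** If there are more than [d] points, they satisfy a linear relation
    [\sum_i u i *: p i = 0], whose sign can be chosen so that [\sum_i u i >= 0].
    Subtracting the largest multiple of [u] that keeps the weights nonnegative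
    kills one of them and does not increase their sum. *)
Lemma conic_caratheodory (R : realFieldType) (d n : nat)
    (p : 'I_n -> 'rV[R]_d) (a : 'I_n -> R) :
  (forall i, 0 <= a i) ->
  exists m (g : 'I_m -> 'I_n) (b : 'I_m -> R),
    [/\ (m <= d)%N, forall i, 0 <= b i, \sum_i b i <= \sum_i a i
      & \sum_i b i *: p (g i) = \sum_i a i *: p i].
Proof.
elim: n p a => [|n IHn] p a a0; first by exists 0, id, a.
have [nd|dn] := leqP n.+1 d; first by exists n.+1, id, a.
have [u [up su0 [i1 ui1]]] : exists u : 'I_n.+1 -> R,
    [/\ \sum_i u i *: p i = 0, 0 <= \sum_i u i & exists i, 0 < u i].
  have [v v0 vp] : exists2 v : 'rV_n.+1, v != 0 & \sum_i v 0 i *: p i = 0.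
    have /rowV0Pn[v /sub_kermxP vA v0] : kermx (\matrix_(i < n.+1) p i) != 0.
      rewrite kermx_eq0 /row_free neq_ltn; apply/orP; left.
      exact: leq_ltn_trans (rank_leq_col _) dn.
    exists v => //; rewrite -[RHS]vA mulmx_sum_row; apply: eq_bigr => i _.
    by rewrite rowK.
  wlog sv0 : v v0 vp / 0 <= \sum_i v 0 i.
    move=> wlogv; have [|sv0] := leP 0 (\sum_i v 0 i); first exact: wlogv.
    apply: (wlogv (- v)); first by rewrite oppr_eq0.
      under eq_bigr do rewrite mxE scaleNr.
      by rewrite sumrN vp oppr0.
    under eq_bigr do rewrite mxE.
    by rewrite sumrN oppr_ge0 ltW.
  exists (v 0); split=> //; apply/existsP; apply: contra_neqT v0.
  rewrite negb_exists => /forallP v_le0.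
  have {}v_le0 i : 0 <= - v 0 i by rewrite oppr_ge0 leNgt.
  apply/rowP => i; rewrite mxE; apply/eqP; rewrite -oppr_eq0; apply/eqP.
  apply: (@psumr_eq0P _ _ xpredT (fun i => - v 0 i)) => //.
  by apply/le_anti; rewrite sumr_ge0// andbT sumrN oppr_le0.
(* The ratio [a i / u i] is the largest admissible multiple. *)
case: (Order.TotalTheory.arg_minP (i0 := i1) (P := fun i => 0 < u i)
  (fun i => a i / u i) ui1) => i ui0 imin.
pose c j := a j - a i / u i * u j.
have r0 : 0 <= a i / u i by rewrite divr_ge0// ltW.
have c0 j : 0 <= c j.
  rewrite subr_ge0; have [uj|uj] := ltP 0 (u j).
    by rewrite -ler_pdivlMr// imin.
  by rewrite (le_trans _ (a0 j))// mulr_ge0_le0.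
have ci : c i = 0 by rewrite /c divfK ?gt_eqF// subrr.
have [m [g [b [md b0 bc bp]]]] := IHn (p \o lift i) (c \o lift i)
  (fun j => c0 (lift i j)).
exists m, (lift i \o g), b; split=> //.
  rewrite (le_trans bc)//= (_ : \sum_j _ = \sum_j c j); last first.
    by rewrite [RHS](bigD1_ord i)//= ci add0r.
  by rewrite big_split/= sumrN -mulr_sumr gerDl oppr_le0 mulr_ge0.
rewrite [LHS]bp /= (_ : \sum_j _ = \sum_j c j *: p j); last first.
  by rewrite [RHS](bigD1_ord i)//= ci scale0r add0r.
rewrite (eq_bigr (fun j => a j *: p j - (a i / u i) *: (u j *: p j)));
  last first.
  by move=> j _; rewrite /c scalerBl scalerA.
by rewrite sumrB -scaler_sumr up scaler0 subr0.
Qed.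

(** * The theorem *)

Lemma card_range_sum_ord (T : Type) (k m : nat) (q : 'I_k + 'I_m -> T) :
  (range q #<= `I_(k + m))%card.
Proof.
have -> : range q = range (q \o @fintype.split k m).
  apply/seteqP; split=> _ [i _ <-]; last by exists (fintype.split i).
  by exists (unsplit i) => //=; rewrite unsplitK.
by apply: card_le_trans (card_image_le _ _) _; rewrite -(card_le_eql card_II).
Qed.

Theorem theorem1 (R : realType) (d : nat) (lambda : R) (Q : set 'rV[R]_d)
    (d_ge1 : (1 <= d)%N) (lambda_gt0 : 0 < lambda) (Q_polytope : polytope Q)
    (Q_sub : Q `<=` [set - lambda *: x | x in Q]) :
  exists V : set 'rV[R]_d,
    [/\ V `<=` vertices Q,
        (V #<= `I_(2 * d)%N)%card
      & Q `<=` [set - ((lambda + 2) * d%:R) *: x | x in convex_hull V]].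
Proof.
have [n [p [QE p_vert]]] := polytope_vertices Q_polytope.
case: n p QE p_vert => [|n] p QE p_vert.
  exists set0; split=> // x.
  rewrite QE => /convex_hull_rangeP[a [_ + _]].
  by rewrite big_ord0 => /eqP; rewrite eq_sym oner_eq0.
have Qconv : convex_set Q by rewrite QE; exact: convex_hull_convex.
have Qp i : Q (p i) by rewrite QE; apply: sub_convex_hull; exists i.
have d_gt0 : 0 < d%:R :> R by rewrite ltr0n.
have [f fP] := bounded_coordinates_padded p ord0.
(* [- s] is a conic combination of total weight [lambda * d]: apply [Q_sub] to
   the centroid [s / d]. *)
pose s := \sum_i p (f i).
have sum1d : \sum_(i < d) (1 : R) = d%:R by rewrite sumr_const card_ord.
have [a [a0 a1 ap]] : exists a : 'I_n.+1 -> R,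
    [/\ forall i, 0 <= a i, \sum_i a i = lambda * d%:R
      & \sum_i a i *: p i = - s].
  have : Q (d%:R^-1 *: s).
    rewrite -sum1d (_ : s = \sum_i 1 *: p (f i)).
      by apply: convex_barycenter => //; rewrite sum1d.
    by apply: eq_bigr => i _; rewrite scale1r.
  move=> /Q_sub[x]; rewrite QE => /convex_hull_rangeP[a [a0 a1 xE]] sE.
  exists (fun i => lambda * d%:R * a i); split.
  - by move=> i; rewrite !mulr_ge0// ltW.
  - by rewrite -mulr_sumr a1 mulr1.
  - under eq_bigr do rewrite -scalerA.
    rewrite -scaler_sumr -xE -[s](scalerKV (lt0r_neq0 d_gt0)) -sE.
    by rewrite !scaleNr scalerN opprK scalerA mulrC.
have [m [g [b [md b0 b_le bg]]]] := conic_caratheodory p a0.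
rewrite {}a1 in b_le; rewrite {a a0}ap in bg.
pose q (e : 'I_d + 'I_m) := match e with inl i => p (f i) | inr j => p (g j) end.
pose K := convex_hull (range q).
have Kconv : convex_set K by exact: convex_hull_convex.
have Kq e : K (q e) by apply: sub_convex_hull; exists e.
have sum_q (w : 'I_d -> R) : \sum_e (match e with inl i => w i | inr j => b j end)
    *: q e = \sum_i w i *: p (f i) - s.
  by rewrite big_sumType/= bg.
have sum_w (w : 'I_d -> R) : \sum_(e : 'I_d + 'I_m)
    (match e with inl i => w i | inr j => b j end) = \sum_i w i + \sum_j b j.
  by rewrite big_sumType.
(* The weights [1] on the [p (f i)] and [b] on the [p (g j)] balance out. *)
have K0 : K 0.
  have := @convex_barycenter R _ _ K
    (fun e => match e with inl i => 1 | inr j => b j end) q Kconv Kq.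
  rewrite sum_q sum_w sum1d (_ : \sum_i 1 *: p (f i) = s).
    rewrite subrr scaler0; apply; first by case.
    by rewrite ltr_pwDl// sumr_ge0.
  by apply: eq_bigr => i _; rewrite scale1r.
pose D := (lambda + 2) * d%:R.
have D_gt0 : 0 < D by rewrite mulr_gt0// addr_gt0.
exists (range q); split.
- by move=> _ [[i|j] _ <-]; exact: p_vert.
- apply: card_le_trans (card_range_sum_ord q) _.
  by rewrite card_le_II mul2n -addnn leq_add2l.
- (* By convexity it is enough to treat the points [p j]. *)
  suff QK : Q `<=` [set x | K (- D^-1 *: x)].
    move=> x /QK Kx; exists (- D^-1 *: x) => //.
    by rewrite !scaleNr scalerN opprK scalerA divff ?gt_eqF// scale1r.
  rewrite QE; apply: convex_hull_min.
    apply/convex_setP => x y t Kx Ky t01 /=.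
    have /convex_setP := Kconv => /(_ _ _ t Kx Ky t01).
    by rewrite scalerDr !scalerA ![_ * - _]mulrC.
  (* [- p j = (s - p j) - s], with [s - p j = \sum_i (1 - c i) *: p (f i)]. *)
  move=> _ [j _ <-] /=; have [c c1 pE] := fP j.
  have /= := @convex_subbarycenter R _ _ K
    (fun e => match e with inl i => 1 - c i | inr j => b j end) q D Kconv K0 Kq.
  rewrite (sum_q (fun i => 1 - c i)) (sum_w (fun i => 1 - c i)).
  rewrite (_ : \sum_i _ = s - p j); last first.
    rewrite pE -sumrB; apply: eq_bigr => i _.
    by rewrite scalerBl scale1r.
  rewrite addrAC subrr add0r scalerN -scaleNr; apply=> //.
    case=> [i|//]; move: (c1 i); rewrite ler_norml => /andP[_].
    by rewrite subr_ge0.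
  rewrite /D mulrDl addrC lerD// mulr_natr -[d in X in _ <= X]card_ord.
  rewrite -sumr_const; apply: ler_sum => i _.
  by move: (c1 i); rewrite ler_norml => /andP[+ _]; lra.
Qed.
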